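(* Let $\mathcal{H}=\mathcal{H}_1\otimes\mathcal{H}_2\otimes\mathcal{H}_3$ with $\dim\mathcal{H}_i=d_i$ and let $U\in SU(d_1d_2d_3)$ act on $\mathcal{H}$. Then $\epsilon_1(U)=\frac13[\epsilon_{12|3}(U)+\epsilon_{13|2}(U)+\epsilon_{23|1}(U)]$, and for each $ab|c\in\{12|3,13|2,23|1\}$, $$\epsilon_{ab|c}(U)=2\left[1-\Bigg(\prod_{i=1}^3\frac{d_i}{d_i+1}\Bigg)\sum_{x'|y'}\operatorname{tr}\big[(\operatorname{tr}_{abx'}|U\rangle\langle U|)^2\big]\right],$$ where the sum runs over all eight ordered bipartitions $x'|y'$ of $\{1',2',3'\}$, i.e. $x'|y'\in\{1'2'3'|\cdot,\ 1'2'|3',\ 1'3'|2',\ 2'3'|1',\ 1'|2'3',\ 2'|1'3',\ 3'|1'2',\ \cdot|1'2'3'\}$ (a dot denoting the empty set), and $\operatorname{tr}_{abx'}$ denotes the partial trace over the factors $\mathcal{H}_a,\mathcal{H}_b$ and $\mathcal{H}_{i'}$ for $i'\in x'$.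
   Context: Let $\mathcal{H}'=\mathcal{H}_{1'}\otimes\mathcal{H}_{2'}\otimes\mathcal{H}_{3'}$ be a copy of $\mathcal{H}$ with $\dim\mathcal{H}_{i'}=d_i$. Given orthonormal bases, the state associated with $U$ is $|U\rangle=\frac{1}{\sqrt{d_1d_2d_3}}\sum \langle j_1j_2j_3|U|j_{1'}j_{2'}j_{3'}\rangle\,|j_1j_2j_3\rangle\otimes|j_{1'}j_{2'}j_{3'}\rangle\in\mathcal{H}\otimes\mathcal{H}'$ (sum over all indices). For a pure state $|\psi\rangle\in\mathcal{H}$ and a bipartition $g|g'$ of $\{1,2,3\}$, $\tau_{g|g'}(|\psi\rangle)=2\big(1-\operatorname{tr}[(\operatorname{tr}_g|\psi\rangle\langle\psi|)^2]\big)$; the one-tangle is $\tau_1=\frac13(\tau_{12|3}+\tau_{13|2}+\tau_{23|1})$. $\epsilon_{ab|c}(U)$ (resp. $\epsilon_1(U)$) is the average of $\tau_{ab|c}(U|\psi_{\rm sep}\rangle)$ (resp. $\tau_1(U|\psi_{\rm sep}\rangle)$) over $|\psi_{\rm sep}\rangle=|\psi_1\rangle\otimes|\psi_2\rangle\otimes|\psi_3\rangle$, each $|\psi_i\rangle$ drawn independently from the unitarily invariant measure on pure states of $\mathcal{H}_i$. *)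

(* Defs.v *)
(* Complex numbers are R[i] (real_closed/complex)
   over an arbitrary R : realType. *)
From HB Require Import structures.
From mathcomp Require Import all_boot all_order all_algebra.
From mathcomp Require Import complex.
From mathcomp Require Import all_classical all_reals all_analysis.
Set Implicit Arguments. Unset Strict Implicit. Unset Printing Implicit Defensive.
Import Order.TTheory GRing.Theory Num.Theory.
Import numFieldNormedType.Exports.
Local Open Scope classical_set_scope.
Local Open Scope ring_scope.

Section QDefs.
Variable R : realType.
Local Notation C := (R[i]).

(** ** Multipartite configurations: a basis index of H_0 (x) ... (x) H_(n-1)
    with dim H_k = dims k is a dependent finite function. *)
Definition config (n : nat) (dims : 'I_n -> nat) :=
  {dffun forall k : 'I_n, 'I_(dims k)}.

(** [agree S x y] : the basis indices x and y coincide on all factors in S. *)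
Definition agree n (dims : 'I_n -> nat) (S : {set 'I_n}) (x y : config dims) : bool :=
  [forall k in S, x k == y k].

(** tr[(tr_S |phi><phi|)^2] for a (not necessarily normalized) vector phi, written
    out in coordinates: with rho' := tr_S |phi><phi|, whose kernel is
    rho'(a,a') = sum_b phi(a,b) phi(a',b)^*  (a, a' indices of the kept factors,
    b of the traced factors S), one has
    tr rho'^2 = sum_{a,a',b,b'} phi(a,b) phi(a',b)^* phi(a',b') phi(a,b')^*.
    Here x=(a,b), y=(a',b), z=(a',b'), w=(a,b'). *)
Definition trsq_ptrace n (dims : 'I_n -> nat) (S : {set 'I_n})
    (phi : config dims -> C) : C :=
  \sum_(x : config dims) \sum_(y : config dims) \sum_(z : config dims)
    \sum_(w : config dims)
    ((agree S x y && agree S z w && agree (~: S) x w && agree (~: S) y z)%:R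
      * phi x * (phi y)^* * phi z * (phi w)^*).

(** Tripartite system H_1 (x) H_2 (x) H_3 (factors indexed 0,1,2). *)
Definition dims3 (d1 d2 d3 : nat) : 'I_3 -> nat :=
  fun k => nth 0%N [:: d1; d2; d3] (val k).
Definition o0 : 'I_3 := @Ordinal 3 0 isT.
Definition o1 : 'I_3 := @Ordinal 3 1 isT.
Definition o2 : 'I_3 := @Ordinal 3 2 isT.

(** Identification of 'I_(d1*d2*d3) with triples of basis indices (product basis). *)
Definition idx3 d1 d2 d3 (j1 : 'I_d1) (j2 : 'I_d2) (j3 : 'I_d3) : 'I_(d1 * d2 * d3) :=
  mxvec_index (mxvec_index j1 j2) j3.

(** Conjugate transpose and unitarity / special unitary group. *)
Definition adjmx m n (A : 'M[C]_(m, n)) : 'M[C]_(n, m) := (map_mx Num.conj A)^T.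
Definition unitary_mx n (V : 'M[C]_n) : Prop := V *m adjmx V = 1%:M.
Definition special_unitary n (V : 'M[C]_n) : Prop := unitary_mx V /\ \det V = 1.

(** Coordinates of U (psi_1 (x) psi_2 (x) psi_3) in the product basis. *)
Definition out_state d1 d2 d3 (U : 'M[C]_(d1 * d2 * d3))
    (p1 : 'cV[C]_d1) (p2 : 'cV[C]_d2) (p3 : 'cV[C]_d3) :
    config (dims3 d1 d2 d3) -> C :=
  fun x => \sum_(y : config (dims3 d1 d2 d3))
     U (idx3 (x o0) (x o1) (x o2)) (idx3 (y o0) (y o1) (y o2))
       * p1 (y o0) 0 * p2 (y o1) 0 * p3 (y o2) 0.

(** tau_{g|g'}(|psi>) = 2 (1 - tr[(tr_g |psi><psi|)^2]) *)
Definition tau3 d1 d2 d3 (g : {set 'I_3}) (phi : config (dims3 d1 d2 d3) -> C) : R :=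
  2 * (1 - complex.Re (trsq_ptrace g phi)).

(** one-tangle tau_1 = (tau_{12|3} + tau_{13|2} + tau_{23|1}) / 3 *)
Definition tau1 d1 d2 d3 (phi : config (dims3 d1 d2 d3) -> C) : R :=
  (tau3 [set o0; o1]%SET phi + tau3 [set o0; o2]%SET phi + tau3 [set o1; o2]%SET phi) / 3%:R.

(** Random pure states: a probability space with a map psi into unit vectors of
    C^d whose coordinates are measurable and whose law is unitarily invariant. *)
Definition unit_vec d (v : 'cV[C]_d) : Prop := \sum_(j < d) v j 0 * (v j 0)^* = 1.

Definition random_pure_state dT (T : measurableType dT) (P : probability T R)
    d (psi : T -> 'cV[C]_d) : Prop :=
  [/\ forall t, unit_vec (psi t),
      forall j : 'I_d, measurable_fun setT (fun t => complex.Re (psi t j 0)) /\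
                       measurable_fun setT (fun t => complex.Im (psi t j 0)) &
      forall V : 'M[C]_d, unitary_mx V ->
      forall A : set 'cV[C]_d, measurable (psi @^-1` A) ->
        measurable ((fun t => V *m psi t) @^-1` A) /\
        P (psi @^-1` A) = P ((fun t => V *m psi t) @^-1` A)].

(** Average over |psi_sep> = |psi_1>|psi_2>|psi_3> with independent psi_i
    (iterated integral against the three laws). *)
Definition avg3 dT1 dT2 dT3 (T1 : measurableType dT1) (T2 : measurableType dT2)
    (T3 : measurableType dT3) (P1 : probability T1 R) (P2 : probability T2 R)
    (P3 : probability T3 R) (F : T1 -> T2 -> T3 -> R) : R :=
  Rintegral P1 setT (fun t1 => Rintegral P2 setT (fun t2 =>
    Rintegral P3 setT (fun t3 => F t1 t2 t3))).

(** Six-partite system H_1 H_2 H_3 H_1' H_2' H_3' (factors 0..5). *)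
Definition dims6 (d1 d2 d3 : nat) : 'I_6 -> nat :=
  fun k => nth 0%N [:: d1; d2; d3; d1; d2; d3] (val k).
Definition q0 : 'I_6 := @Ordinal 6 0 isT.
Definition q1 : 'I_6 := @Ordinal 6 1 isT.
Definition q2 : 'I_6 := @Ordinal 6 2 isT.
Definition q3 : 'I_6 := @Ordinal 6 3 isT.
Definition q4 : 'I_6 := @Ordinal 6 4 isT.
Definition q5 : 'I_6 := @Ordinal 6 5 isT.

(** |U> = (d1 d2 d3)^(-1/2) sum <j1j2j3|U|j1'j2'j3'> |j1j2j3>|j1'j2'j3'> *)
Definition choi_state d1 d2 d3 (U : 'M[C]_(d1 * d2 * d3)) :
    config (dims6 d1 d2 d3) -> C :=
  fun x => (sqrtC ((d1 * d2 * d3)%N%:R))^-1 *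
    U (idx3 (x q0) (x q1) (x q2)) (idx3 (x q3) (x q4) (x q5)).

(** embedding of factor k of the unprimed system into the six-partite one *)
Definition unprimed (k : 'I_3) : 'I_6 := widen_ord (isT : (3 <= 6)%N) k.
Definition primed : {set 'I_6} := [set q3; q4; q5]%SET.

End QDefs.

(* Main.v *)
(* The fourth moments of a Haar-random unit vector of C^d are
     E[p_x conj(p_y) p_z conj(p_w)]
       = ([x = y][z = w] + [x = w][y = z]) / (d (d + 1)).
   Invariance under multiplication of one coordinate by i kills all the other
   moments; invariance under one reflection with rational entries in each
   coordinate plane shows that E|p_i|^4 is a constant A and
   E(|p_i|^2 |p_j|^2) = A / 2 for i != j; normalization then gives A.

   The purity tr[(tr_g |U psi><U psi|)^2] is linear in the product of the three
   fourth-order tensors of psi_1, psi_2, psi_3.  Averaging, each factor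
   contributes one of two contraction patterns, and expanding the product over
   the three factors yields a sum over the subsets x' of {1', 2', 3'}.  The term
   of x' is the contraction that defines the purity of tr_{g x'} |U><U|. *)
Require Import Defs.
From HB Require Import structures.
From mathcomp Require Import all_boot all_order all_algebra.
From mathcomp Require Import complex.
From mathcomp Require Import all_classical all_reals all_analysis.
From mathcomp Require Import measurable_realfun ring.
Import Order.TTheory GRing.Theory Num.Theory.
Import numFieldNormedType.Exports.
Local Open Scope ring_scope.
Set Implicit Arguments.
Unset Strict Implicit.
Unset Printing Implicit Defensive.

(** * Expectation of complex random variables, taken componentwise *)

Section ComplexExpectation.
Context {R : realType} {dT : measure_display} {T : measurableType dT}.
Variable P : probability T R.
Local Notation C := (R[i]).
Local Notation Re := (@complex.Re R).
Local Notation Im := (@complex.Im R).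

Definition cmeas (f : T -> C) : Prop :=
  measurable_fun setT (fun t => Re (f t)) /\
  measurable_fun setT (fun t => Im (f t)).

Definition cint (f : T -> C) : Prop :=
  P.-integrable setT (EFin \o (fun t => Re (f t))) /\
  P.-integrable setT (EFin \o (fun t => Im (f t))).

Definition cE (f : T -> C) : C :=
  Complex (Rintegral P setT (fun t => Re (f t)))
          (Rintegral P setT (fun t => Im (f t))).

Lemma complexReD (x y : C) : Re (x + y) = Re x + Re y. Proof. by case: x; case: y. Qed.
Lemma complexImD (x y : C) : Im (x + y) = Im x + Im y. Proof. by case: x; case: y. Qed.
Lemma complexReM (x y : C) : Re (x * y) = Re x * Re y - Im x * Im y.
Proof. by case: x; case: y. Qed.
Lemma complexImM (x y : C) : Im (x * y) = Re x * Im y + Im x * Re y.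
Proof. by case: x => a b; case: y => c d /=. Qed.
Lemma complexReJ (x : C) : Re x^* = Re x. Proof. by case: x. Qed.
Lemma complexImJ (x : C) : Im x^* = - Im x. Proof. by case: x. Qed.

Lemma cmeasM f g : cmeas f -> cmeas g -> cmeas (fun t => f t * g t).
Proof.
move=> [fr fi] [gr gi]; split.
  under eq_fun do rewrite complexReM.
  by apply: measurable_funB; apply: measurable_funM.
under eq_fun do rewrite complexImM.
by apply: measurable_funD; apply: measurable_funM.
Qed.

Lemma cmeasJ f : cmeas f -> cmeas (fun t => (f t)^*).
Proof.
move=> [fr fi]; split; first by under eq_fun do rewrite complexReJ.
by under eq_fun do rewrite complexImJ; apply: measurableT_comp.
Qed.

Lemma cint_cst (c : C) : cint (fun=> c).
Proof. by split; apply: finite_measure_integrable_cst. Qed.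

Lemma Re_le_norm (z : C) : `|Re z| <= Re `|z|.
Proof.
by have := normc_ge_Re z; rewrite lecE => /andP[_].
Qed.

Lemma cint_bounded f : cmeas f -> (forall t, `|f t| <= 1) -> cint f.
Proof.
move=> [fr fi] f1.
have P1 : (P setT < +oo)%E by rewrite probability_setT ltry.
have Reb (g : T -> C) : (forall t, `|g t| <= 1) ->
    [bounded (fun t => Re (g t)) x | x in setT].
  move=> g1; exists 1; split => // M M1 t _ /=.
  apply: le_trans (ltW M1); apply: le_trans (Re_le_norm _) _.
  by have := g1 t; rewrite lecE => /andP[_].
split; apply: measurable_bounded_integrable => //; first exact: Reb.
(* Since [Im z] is the real part of -i z and |-i z| = |z|, the bound on real parts also covers
   imaginary parts. *)
have -> : (fun t => Im (f t)) = (fun t => Re (- 'i * f t)).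
  apply/funext => t; rewrite mulNr mulrC -complexiE -mulrN.
  by case: (f t) => a b /=; ring.
apply: Reb => t; rewrite normrM normrN normCi mul1r; exact: f1.
Qed.

Lemma cintD f g : cint f -> cint g -> cint (fun t => f t + g t).
Proof.
move=> [fr fi] [gr gi]; split.
  have -> : EFin \o (fun t => Re (f t + g t)) =
     (EFin \o (fun t => Re (f t))) \+ (EFin \o (fun t => Re (g t))).
    by apply/funext => t /=; rewrite complexReD EFinD.
  exact: integrableD.
have -> : EFin \o (fun t => Im (f t + g t)) =
     (EFin \o (fun t => Im (f t))) \+ (EFin \o (fun t => Im (g t))).
  by apply/funext => t /=; rewrite complexImD EFinD.
exact: integrableD.
Qed.

Lemma integrable_lin (a b : R) (f g : T -> R) :
  P.-integrable setT (EFin \o f) -> P.-integrable setT (EFin \o g) ->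
  P.-integrable setT (EFin \o (fun t => a * f t + b * g t)).
Proof.
move=> fi gi.
have -> : EFin \o (fun t => a * f t + b * g t) =
   (fun t => a%:E * (EFin \o f) t)%E \+ (fun t => b%:E * (EFin \o g) t)%E.
  by apply/funext => t /=; rewrite EFinD !EFinM.
by apply: integrableD => //; apply: integrableZl.
Qed.

Lemma Rintegral_lin (a b : R) (f g : T -> R) :
  P.-integrable setT (EFin \o f) -> P.-integrable setT (EFin \o g) ->
  Rintegral P setT (fun t => a * f t + b * g t) =
  a * Rintegral P setT f + b * Rintegral P setT g.
Proof.
move=> fi gi; rewrite RintegralD//; first by rewrite !RintegralZl.
- have -> : EFin \o (fun t => a * f t) = (fun t => a%:E * (EFin \o f) t)%E.
    by apply/funext => t /=; rewrite EFinM.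
  exact: integrableZl.
- have -> : EFin \o (fun t => b * g t) = (fun t => b%:E * (EFin \o g) t)%E.
    by apply/funext => t /=; rewrite EFinM.
  exact: integrableZl.
Qed.

Lemma cintZ c f : cint f -> cint (fun t => c * f t).
Proof.
move=> [fr fi]; split.
  under [X in _ \o X]eq_fun do rewrite complexReM -mulNr.
  exact: integrable_lin.
under [X in _ \o X]eq_fun do rewrite complexImM.
exact: integrable_lin.
Qed.

Lemma cE_D f g : cint f -> cint g -> cE (fun t => f t + g t) = cE f + cE g.
Proof.
move=> [fr fi] [gr gi]; rewrite /cE.
rewrite (eq_fun (fun t => complexReD (f t) (g t))) (eq_fun (fun t => complexImD (f t) (g t))).
by rewrite !RintegralD.
Qed.

Lemma cE_Z c f : cint f -> cE (fun t => c * f t) = c * cE f.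
Proof.
move=> [fr fi]; rewrite /cE.
rewrite (eq_fun (fun t => complexReM c (f t))) (eq_fun (fun t => complexImM c (f t))).
under eq_fun do rewrite -mulNr.
by rewrite !Rintegral_lin//; case: c => a b /=; rewrite mulNr.
Qed.

Lemma Rintegral_probability_cst (r : R) : Rintegral P setT (fun=> r) = r.
Proof.
rewrite Rintegral_cst//; transitivity (r * fine 1%E); last by rewrite mulr1.
by congr (_ * fine _); exact: probability_setT.
Qed.

Lemma cE_cst c : cE (fun=> c) = c.
Proof. by rewrite /cE !Rintegral_probability_cst; case: c. Qed.

Lemma cint_sum (I : Type) (r : seq I) (f : I -> T -> C) :
  (forall i, cint (f i)) -> cint (fun t => \sum_(i <- r) f i t).
Proof.
move=> fi; elim: r => [|i r IH].
  under eq_fun do rewrite big_nil; exact: cint_cst.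
under eq_fun do rewrite big_cons; exact: cintD.
Qed.

Lemma cE_sum (I : Type) (r : seq I) (f : I -> T -> C) :
  (forall i, cint (f i)) ->
  cE (fun t => \sum_(i <- r) f i t) = \sum_(i <- r) cE (f i).
Proof.
move=> fi; elim: r => [|i r IH].
  under eq_fun do rewrite big_nil; by rewrite cE_cst big_nil.
under eq_fun do rewrite big_cons; rewrite cE_D ?IH ?big_cons//.
exact: cint_sum.
Qed.

(** A tangle depends on the purity through 2 (1 - Re purity), so its average is the same expression
    in the averaged purity. *)
Lemma Rintegral_affine_Re f : cint f ->
  Rintegral P setT (fun t => 2 * (1 - Re (f t))) = 2 * (1 - Re (cE f)).
Proof.
move=> [fr fi].
have -> : (fun t => 2 * (1 - Re (f t))) =
          (fun t => 2 * cst (1 : R) t + (- 2) * Re (f t)).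
  by apply/funext => t /=; ring.
rewrite Rintegral_lin//; last exact: finite_measure_integrable_cst.
by rewrite Rintegral_probability_cst /cE /=; ring.
Qed.

End ComplexExpectation.

(** * Fourth moments of a unitarily invariant random unit vector *)

Section Moments.
Context {R : realType} {dT : measure_display} {T : measurableType dT}.
Variables (P : probability T R) (d : nat) (psi : T -> 'cV[R[i]]_d).
Hypothesis hpsi : random_pure_state P psi.
Local Notation C := (R[i]).

Lemma Rintegral_invariant (V : 'M[C]_d) (h : 'cV[C]_d -> R) :
  unitary_mx V -> measurable_fun setT (fun t => h (psi t)) ->
  Rintegral P setT (fun t => h (V *m psi t)) =
  Rintegral P setT (fun t => h (psi t)).
Proof.
case: hpsi => _ _ inv uV mh.
have hB (B : set R) : measurable B ->
    measurable ((fun t => h (V *m psi t)) @^-1` B)%classic /\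
    P ((fun t => h (psi t)) @^-1` B)%classic =
    P ((fun t => h (V *m psi t)) @^-1` B)%classic.
  move=> mB; apply: (inv V uV (h @^-1` B)%classic).
  by rewrite -[X in measurable X]setTI; exact: mh.
have mhV : measurable_fun setT (fun t => h (V *m psi t)).
  by move=> _ B mB; rewrite setTI; exact: (hB B mB).1.
(* Here [f] will be the positive, then the negative part of [EFin]. *)
have mE (f : R -> \bar R) : measurable_fun setT f -> (forall x, 0 <= f x)%E ->
    (\int[P]_t f (h (V *m psi t)) = \int[P]_t f (h (psi t)))%E.
  move=> mf f0.
  have := ge0_integral_pushforward mhV P measurableT mf (fun x _ => f0 x).
  have := ge0_integral_pushforward mh P measurableT mf (fun x _ => f0 x).
  rewrite !preimage_setT /= => <- <-.
  by apply: eq_measure_integral => B mB _; rewrite /pushforward; exact/esym/(hB B mB).2.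
rewrite /Rintegral; congr fine; rewrite [LHS]integralE [RHS]integralE; congr (_ - _)%E.
  rewrite (funepos_comp EFin (fun t => h (V *m psi t))) (funepos_comp EFin (fun t => h (psi t))).
  by apply: mE => //; apply: measurable_funepos; exact: EFin_measurable.
rewrite (funeneg_comp EFin (fun t => h (V *m psi t))) (funeneg_comp EFin (fun t => h (psi t))).
by apply: mE => //; apply: measurable_funeneg; exact: EFin_measurable.
Qed.

Lemma cE_invariant (V : 'M[C]_d) (g : 'cV[C]_d -> C) :
  unitary_mx V -> cmeas (fun t => g (psi t)) ->
  cE P (fun t => g (V *m psi t)) = cE P (fun t => g (psi t)).
Proof.
move=> uV [mr mi]; congr Complex.
  exact: (Rintegral_invariant (h := fun v => complex.Re (g v)) uV mr).
exact: (Rintegral_invariant (h := fun v => complex.Im (g v)) uV mi).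
Qed.

Definition monom4 (x y z w : 'I_d) (v : 'cV[C]_d) : C :=
  v x 0 * (v y 0)^* * v z 0 * (v w 0)^*.

Definition moment4 x y z w : C := cE P (fun t => monom4 x y z w (psi t)).

Lemma cmeas_monom4 x y z w : cmeas (fun t => monom4 x y z w (psi t)).
Proof.
case: hpsi => _ m _.
have mc j : cmeas (fun t => psi t j 0) by exact: m.
by do !apply: cmeasM => //; apply: cmeasJ.
Qed.

Lemma norm_coord_le1 t j : `|psi t j 0| <= 1.
Proof.
case: hpsi => u _ _; have := u t; rewrite /unit_vec => u1.
rewrite -(@expr_le1 _ 2)// -u1 normCK (bigD1 j)//= lerDl sumr_ge0// => i _.
exact: mul_conjC_ge0.
Qed.

Lemma cint_monom4 x y z w : cint P (fun t => monom4 x y z w (psi t)).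
Proof.
apply: cint_bounded; first exact: cmeas_monom4.
move=> t; rewrite !normrM !norm_conjC.
by do !(apply: mulr_ile1; rewrite ?mulr_ge0//; try exact: norm_coord_le1).
Qed.

(** The diagonal unitary that multiplies coordinate [a] by i multiplies the monomial by the phase on
    the left of the inequality. By invariance the moment equals its product with this phase, so it
    vanishes unless the phase is 1. *)
Lemma moment4_eq0 (a x y z w : 'I_d) :
  let f := fun k : 'I_d => (if k == a then 'i else 1 : C) in
  f x * (f y)^* * f z * (f w)^* != 1 -> moment4 x y z w = 0.
Proof.
move=> f fN1.
pose V : 'M[C]_d := diag_mx (\row_k f k).
have uV : unitary_mx V.
  apply/matrixP => i j; rewrite mul_diag_mx !mxE.
  rewrite rmorphMn /= [j == i]eq_sym; case: eqP => [->|_]; last by rewrite mulr0.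
  rewrite !mulr1n /f; case: ifP => _; last by rewrite conjC1 mulr1.
  by rewrite conjCi mulrN -expr2 sqrCi opprK.
have := cE_invariant uV (cmeas_monom4 x y z w).
have -> : (fun t => monom4 x y z w (V *m psi t)) =
    (fun t => f x * (f y)^* * f z * (f w)^* * monom4 x y z w (psi t)).
  apply/funext => t; rewrite /monom4 mul_diag_mx !mxE !rmorphM /=; ring.
rewrite cE_Z; last exact: cint_monom4.
rewrite -/(moment4 x y z w) => /eqP.
rewrite -subr_eq0 -{2}[moment4 _ _ _ _]mul1r -mulrBl mulf_eq0 subr_eq0.
by rewrite (negbTE fN1) => /eqP.
Qed.

(** The multiplier is i and not -1 because a change of sign would not detect moments such as that of
    p_x^2 conj(p_y)^2. *)
Lemma moment4_vanish (x y z w : 'I_d) :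
  ~~ ((x == y) && (z == w)) -> ~~ ((x == w) && (y == z)) ->
  moment4 x y z w = 0.
Proof.
have i1 : 'i != 1 :> C.
  by apply/eqP => /(congr1 (fun u => u * u)); rewrite -expr2 sqrCi mulr1 => /eqP;
     rewrite eqNr oner_eq0.
have N1 : -1 != 1 :> C by rewrite eqNr oner_eq0.
have [<-{y}|xy] := eqVneq x y => /=.
  (* The factors of x = y cancel and z differs from w, so the phase is i. *)
  move=> zw _; apply: (@moment4_eq0 z) => /=; rewrite eqxx [w == z]eq_sym (negbTE zw).
  by case: (x == z); rewrite conjC1 !(mulr1, mul1r) // conjCi mulrN -expr2 sqrCi opprK mul1r.
move=> _; have [<-{w}|xw] := eqVneq x w => /=.
  move=> yz; apply: (@moment4_eq0 z) => /=; rewrite eqxx (negbTE yz).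
  case: (x == z); rewrite ?conjC1 !(mulr1, mul1r) //.
  by rewrite mulrAC conjCi mulrN -expr2 sqrCi opprK mul1r.
(* Neither conjugated index equals x, so the phase is i, or i^2 = -1 when z = x. *)
move=> _; apply: (@moment4_eq0 x) => /=; rewrite eqxx [y == x]eq_sym (negbTE xy).
rewrite [w == x]eq_sym (negbTE xw) conjC1 !mulr1.
by case: (z == x); rewrite ?mulr1 // -expr2 sqrCi.
Qed.

Lemma moment4_swap x y : moment4 x y y x = moment4 x x y y.
Proof. by congr cE; apply/funext => t; rewrite /monom4; ring. Qed.

Lemma moment4_sym x y : moment4 x x y y = moment4 y y x x.
Proof. by congr cE; apply/funext => t; rewrite /monom4; ring. Qed.

(* Invariance under the reflection 1 - (2/5) w w^T with w = e_i + 2 e_j,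
   whose i-th row is (3/5) e_i - (4/5) e_j. *)
Lemma moment4_reflect (i j : 'I_d) : i != j ->
  625 * moment4 i i i i =
  81 * moment4 i i i i + 576 * moment4 i i j j + 256 * moment4 j j j j.
Proof.
move=> ij.
pose w : 'cV[C]_d := delta_mx i 0 + 2 *: delta_mx j 0.
pose V : 'M[C]_d := 1%:M - (2 / 5) *: (w *m w^T).
have wT : w^T = delta_mx 0 i + 2 *: delta_mx 0 j.
  by rewrite /w linearD linearZ /= !trmx_delta.
(* The squared norm is 1 + 4 = 5, so that 2/5 is the coefficient of a reflection. Its square is 1
   because -4/5 + (4/25) 5 = 0. *)
have ww : w^T *m w = 5%:M.
  rewrite wT /w mulmxDl !mulmxDr -!scalemxAl -!scalemxAr.
  rewrite !mul_delta_mx_cond !eqxx [j == i]eq_sym (negbTE ij) !mulr1n !mulr0n.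
  rewrite !scaler0 addr0 add0r scalerA; apply/matrixP => a b; rewrite !mxE !ord1 /=; ring.
have Vadj : adjmx V = V.
  rewrite /adjmx /V map_mxB map_mx1 map_mxZ map_mxM linearB /= trmx1 linearZ /= trmx_mul.
  have wc : map_mx Num.conj w = w.
    by apply/matrixP => a b; rewrite !mxE rmorphD rmorphM /= !conjC_nat.
  have c25 : (2 / 5 : C)^* = 2 / 5 by rewrite rmorphM fmorphV /= !conjC_nat.
  by rewrite map_trmx trmxK c25 !wc.
have uV : unitary_mx V.
  rewrite /unitary_mx Vadj /V mulmxBl mul1mx mulmxBr mulmx1 -!scalemxAl -!scalemxAr.
  rewrite -mulmxA (mulmxA w^T) ww mul_scalar_mx -scalemxAr !scalerA.
  by apply/matrixP => a b; rewrite !mxE; field.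
have Vi (p : 'cV[C]_d) : (V *m p) i 0 = 3 / 5 * p i 0 - 4 / 5 * p j 0.
  rewrite /V mulmxBl mul1mx -scalemxAl -mulmxA wT.
  rewrite [in X in _ *m X]mulmxDl -scalemxAl -!rowE !mxE big_ord1 !mxE !eqxx (negbTE ij) /=.
  by field.
have := cE_invariant uV (cmeas_monom4 i i i i).
pose k (s : bool) := if s then j else i.
pose c (s : bool) : C := if s then - 4 / 5 else 3 / 5.
(* Each of the four slots picks the term of [i] or of [j], which gives sixteen monomials. *)
have -> : (fun t => monom4 i i i i (V *m psi t)) =
   (fun t => \sum_s1 \sum_s2 \sum_s3 \sum_s4
      c s1 * c s2 * c s3 * c s4 * monom4 (k s1) (k s2) (k s3) (k s4) (psi t)).
  apply/funext => t; rewrite /monom4 !Vi rmorphB !rmorphM /= !fmorphV /= !conjC_nat.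
  rewrite !big_bool /c /k /=; ring.
have ci a b e f : cint P (fun t => c a * c b * c e * c f * monom4 (k a) (k b) (k e) (k f) (psi t)).
  by apply: cintZ; exact: cint_monom4.
rewrite cE_sum; last by move=> a; do 3!(apply: cint_sum => ?); exact: ci.
under eq_bigr => a _.
  rewrite cE_sum; last by move=> b; do 2!(apply: cint_sum => ?); exact: ci.
  under eq_bigr => b _.
    rewrite cE_sum; last by move=> e; apply: cint_sum => ?; exact: ci.
    under eq_bigr => e _.
      rewrite cE_sum; last by move=> f; exact: ci.
      under eq_bigr => f _ do rewrite (cE_Z _ (cint_monom4 _ _ _ _)) -/(moment4 _ _ _ _).
      over.
    over.
  over.
rewrite !big_bool /c /k /=.
have v x y z w' : ~~ ((x == y) && (z == w')) -> ~~ ((x == w') && (y == z)) ->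
  moment4 x y z w' = 0 by exact: moment4_vanish.
have ji : (j == i) = false by rewrite eq_sym (negbTE ij).
(* Ten of the sixteen moments vanish. The survivors are the two pure ones, with weights 81/625 and
   256/625, and four equal mixed ones of weight 144/625 each, whence 576. *)
rewrite (v j j j i) ?(v j j i j) ?(v j i j j) ?(v i j j j) ?(v j i j i) ?(v i j i j)
  ?(v i i i j) ?(v i i j i) ?(v i j i i) ?(v j i i i) ?eqxx ?(negbTE ij) ?ji //.
rewrite !(moment4_swap, moment4_sym j i) -/(moment4 i i i i) => e.
by rewrite -{1}e; field.
Qed.

(** The mixed moment is symmetric in [i] and [j], so it cancels when the reflection identities for
    (i, j) and (j, i) are subtracted. What remains is 625 (a - b) = (81 - 256) (a - b). *)
Lemma moment4_const (i j : 'I_d) : moment4 i i i i = moment4 j j j j.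
Proof.
have [->//|ij] := eqVneq i j.
have e1 := moment4_reflect ij; rewrite eq_sym in ij.
have e2 := moment4_reflect ij; rewrite (moment4_sym j i) in e2.
apply/eqP; rewrite -subr_eq0.
set a := moment4 i i i i in e1 e2 *; set b := moment4 j j j j in e1 e2 *.
set m := moment4 i i j j in e1 e2.
have /eqP : 800 * (a - b) = 0.
  transitivity ((625 * a - (81 * a + 576 * m + 256 * b))
                - (625 * b - (81 * b + 576 * m + 256 * a))); first by ring.
  by rewrite e1 e2 !subrr.
by rewrite mulf_eq0 pnatr_eq0.
Qed.

(** This is the expectation of the squared norm multiplied by itself, which is identically 1. *)
Lemma moment4_sum1 : \sum_i \sum_j moment4 i i j j = 1.
Proof.
have <- : cE P (fun t => \sum_i \sum_j monom4 i i j j (psi t)) = 1.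
  rewrite -[RHS](cE_cst P); congr cE; apply/funext => t.
  have [u _ _] := hpsi; rewrite -[RHS]mulr1 -{1}(u t) -{1}(u t) big_distrl /=.
  apply: eq_bigr => i _; rewrite big_distrr /=; apply: eq_bigr => j _.
  by rewrite /monom4 mulrA.
rewrite cE_sum; last by move=> i; apply: cint_sum => j; exact: cint_monom4.
by apply: eq_bigr => i _; rewrite cE_sum// => j; exact: cint_monom4.
Qed.

Lemma moment4E (x y z w : 'I_d) :
  moment4 x y z w =
  (((x == y) && (z == w))%:R + ((x == w) && (y == z))%:R) / (d * (d + 1))%:R.
Proof.
set A := moment4 x x x x.
have dgt0 : (0 < d)%N by apply: leq_ltn_trans (ltn_ord x).
have AB i j : moment4 i i j j = (1 + (i == j)%:R) * (A / 2).
  have [->|ij] := eqVneq i j; first by rewrite (moment4_const j x) -/A /=; field.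
  have := moment4_reflect ij; rewrite (moment4_const i x) (moment4_const j x) -/A => e.
  (* With equal pure moments the reflection identity reads 288 A = 576 m, so the mixed moment m is A
     / 2. *)
  have -> : moment4 i i j j = (625 * A - 81 * A - 256 * A) / 576.
    by rewrite e; field.
  by rewrite /=; field.
(* The sum of all [moment4 i i j j] is d (d + 1) A / 2, and it equals 1. *)
have AE : A = 2 / (d * (d + 1))%:R.
  have := moment4_sum1.
  under eq_bigr => i _.
    under eq_bigr => j _ do rewrite AB.
    rewrite -big_distrl big_split /= sumr_const card_ord (bigD1 i)//= eqxx.
    rewrite big1 ?addr0; last by move=> j; rewrite eq_sym => /negbTE ->.
    over.
  rewrite sumr_const card_ord -[_ *+ d]mulr_natl natrM natrD => e.
  have d0 : d%:R != 0 :> C by rewrite pnatr_eq0 -lt0n.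
  have d1 : d%:R + 1 != 0 :> C by rewrite natr1 pnatr_eq0.
  transitivity (2 * (d%:R * ((d%:R + 1%:R) * (A / 2))) / (d%:R * (d%:R + 1%:R))).
    by field; rewrite d1 d0.
  by rewrite e mulr1.
have A2 : A / 2 = 1 / (d * (d + 1))%:R by rewrite AE mulrAC divff ?pnatr_eq0.
have [/andP[/eqP <- /eqP <-]|n1] := boolP ((x == y) && (z == w)).
  by rewrite AB A2 andbb mulrA mulr1.
have [/andP[/eqP exw /eqP exz]|n2] := boolP ((x == w) && (y == z)).
  move: n1; rewrite -exw -exz moment4_swap AB A2 [y == x]eq_sym andbb => /negbTE ->.
  by rewrite addr0 add0r mul1r.
by rewrite (moment4_vanish n1 n2) addr0 mul0r.
Qed.
End Moments.

(** * Averages over three independent states *)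

Lemma Rintegral_affine_sum (R : realType) dT (T : measurableType dT)
    (P : probability T R) (I : finType) (c : I -> R[i]) (f : I -> T -> R[i]) :
  (forall i, cint P (f i)) ->
  Rintegral P setT (fun t => 2 * (1 - complex.Re (\sum_i c i * f i t))) =
  2 * (1 - complex.Re (\sum_i c i * cE P (f i))).
Proof.
move=> fi; rewrite Rintegral_affine_Re.
  rewrite cE_sum; last by move=> i; exact: cintZ.
  by under eq_bigr => i _ do rewrite (cE_Z _ (fi i)).
by apply: cint_sum => i; exact: cintZ.
Qed.

(** Each summand is a product of functions of one variable. The integrals are evaluated from the
    innermost outwards: the outer factors count as constants, and the expectations already found
    join the coefficients. *)
Lemma avg3_affine_sum (R : realType) dT1 dT2 dT3 (T1 : measurableType dT1)
    (T2 : measurableType dT2) (T3 : measurableType dT3) (P1 : probability T1 R)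
    (P2 : probability T2 R) (P3 : probability T3 R) (I : finType) (c : I -> R[i])
    (f1 : I -> T1 -> R[i]) (f2 : I -> T2 -> R[i]) (f3 : I -> T3 -> R[i]) :
  (forall i, cint P1 (f1 i)) -> (forall i, cint P2 (f2 i)) ->
  (forall i, cint P3 (f3 i)) ->
  avg3 P1 P2 P3 (fun t1 t2 t3 =>
    2 * (1 - complex.Re (\sum_i c i * (f1 i t1 * f2 i t2 * f3 i t3)))) =
  2 * (1 - complex.Re (\sum_i c i * (cE P1 (f1 i) * cE P2 (f2 i) * cE P3 (f3 i)))).
Proof.
move=> i1 i2 i3; rewrite /avg3.
transitivity (Rintegral P1 setT (fun t1 => 2 * (1 - complex.Re
    (\sum_i c i * cE P2 (f2 i) * cE P3 (f3 i) * f1 i t1)))).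
  congr Rintegral; apply/funext => t1.
  transitivity (Rintegral P2 setT (fun t2 => 2 * (1 - complex.Re
      (\sum_i c i * f1 i t1 * cE P3 (f3 i) * f2 i t2)))).
    congr Rintegral; apply/funext => t2.
    transitivity (Rintegral P3 setT (fun t3 => 2 * (1 - complex.Re
        (\sum_i c i * f1 i t1 * f2 i t2 * f3 i t3)))).
      congr Rintegral; apply/funext => t3; congr (2 * (1 - complex.Re _)).
      by apply: eq_bigr => i _; rewrite !mulrA.
    rewrite Rintegral_affine_sum//; congr (2 * (1 - complex.Re _)).
    by apply: eq_bigr => i _; rewrite mulrAC.
  rewrite Rintegral_affine_sum//; congr (2 * (1 - complex.Re _)).
  by apply: eq_bigr => i _; ring.
rewrite Rintegral_affine_sum//; congr (2 * (1 - complex.Re _)).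
by apply: eq_bigr => i _; ring.
Qed.

(** * Contraction patterns and quartic forms *)

Section Contraction.
Context {R : realType}.
Local Notation C := (R[i]).

(* Whether the four indices contribute to tr rho^2, for rho the partial trace
   over S, as in trsq_ptrace. *)
Definition contracted n (dims : 'I_n -> nat) (S : {set 'I_n})
    (x y z w : config dims) : bool :=
  agree S x y && agree S z w && agree (~: S) x w && agree (~: S) y z.

Lemma prodr_nat_bool (I : finType) (b : pred I) :
  \prod_(i : I) (b i)%:R = [forall i, b i]%:R :> C.
Proof.
have [/forallP h|] := boolP [forall i, b i].
  by rewrite big1// => i _; rewrite h.
rewrite negb_forall => /existsP[i /negbTE bi].
by rewrite (bigD1 i)//= bi mul0r.
Qed.

(** Expanding the product over the factors amounts to choosing the set [S] where the first pattern
    is taken, the second being taken on the complement. *)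
Lemma sum_contracted n (dims : 'I_n -> nat) (x y z w : config dims) :
  \sum_(S : {set 'I_n}) (contracted S x y z w)%:R =
  \prod_(k < n) (((x k == y k) && (z k == w k))%:R
                 + ((x k == w k) && (y k == z k))%:R) :> C.
Proof.
rewrite bigA_distr; apply: eq_bigr => S _.
under eq_bigr => k _ do rewrite -(fun_if (fun b : bool => b%:R)).
rewrite prodr_nat_bool; congr (nat_of_bool _)%:R.
apply/idP/forallP => [/andP[/andP[/andP[/forall_inP h1 /forall_inP h2]
                           /forall_inP h3] /forall_inP h4] k | h].
  by case: ifP => kS; [rewrite h1// h2|rewrite h3 ?h4// inE kS].
rewrite /contracted -!andbA; apply/and4P.
split; apply/forall_inP => k; rewrite ?inE => kS; move: (h k).
- by rewrite kS => /andP[].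
- by rewrite kS => /andP[].
- by rewrite (negbTE kS) => /andP[].
- by rewrite (negbTE kS) => /andP[].
Qed.

(** Quadruples form one finite type, so that four nested sums become a single one that can be
    exchanged and reindexed at once. *)
Definition quad (A : finType) : finType := (A * A * A * A)%type.

Lemma sum_quad (A : finType) (F : A -> A -> A -> A -> C) :
  \sum_x \sum_y \sum_z \sum_w F x y z w =
  \sum_(q : quad A) F q.1.1.1 q.1.1.2 q.1.2 q.2.
Proof. by rewrite !pair_bigA /=; apply: eq_bigr => -[[[x y] z] w] _. Qed.

Lemma prod_sum_quad (A : finType) (f g h k : A -> C) :
  (\sum_x f x) * (\sum_x g x) * (\sum_x h x) * (\sum_x k x) =
  \sum_(q : quad A) f q.1.1.1 * g q.1.1.2 * h q.1.2 * k q.2.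
Proof.
by rewrite big_distrlr pair_bigA /= big_distrlr pair_bigA /= big_distrlr pair_bigA.
Qed.

(** Pulling a quartic form back along the linear map [M]: the inner sum on the right is the
    transformed tensor. *)
Lemma quartic_apply (A B : finType) (a : quad A -> C) (M : A -> B -> C) (v : B -> C) :
  let u x := \sum_y M x y * v y in
  \sum_(q : quad A) a q * u q.1.1.1 * (u q.1.1.2)^* * u q.1.2 * (u q.2)^* =
  \sum_(r : quad B)
    (\sum_(q : quad A) a q * M q.1.1.1 r.1.1.1 * (M q.1.1.2 r.1.1.2)^*
                     * M q.1.2 r.1.2 * (M q.2 r.2)^*)
    * (v r.1.1.1 * (v r.1.1.2)^* * v r.1.2 * (v r.2)^*).
Proof.
move=> u; under [RHS]eq_bigr => r _ do rewrite big_distrl.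
rewrite [RHS]exchange_big; apply: eq_bigr => q _ /=.
transitivity (a q * (u q.1.1.1 * (u q.1.1.2)^* * u q.1.2 * (u q.2)^*)).
  by rewrite !mulrA.
rewrite /u !rmorph_sum prod_sum_quad big_distrr; apply: eq_bigr => r _ /=.
by rewrite !rmorphM /=; ring.
Qed.
End Contraction.

(** * Bipartitions of the six factors and purities as contractions *)

Section Bipartition.
Context {R : realType} {d1 d2 d3 : nat}.
Local Notation C := (R[i]).
Local Notation cfg := (config (dims3 d1 d2 d3)).
Local Notation cfg6 := (config (dims6 d1 d2 d3)).

Lemma forall_ord3 (Q : 'I_3 -> Prop) : Q o0 -> Q o1 -> Q o2 -> forall k, Q k.
Proof.
by move=> Q0 Q1 Q2 [[|[|[|//]]] h]; rewrite (bool_irrelevance h isT).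
Qed.

Lemma forall_ord6 (Q : 'I_6 -> Prop) :
  Q q0 -> Q q1 -> Q q2 -> Q q3 -> Q q4 -> Q q5 -> forall k, Q k.
Proof.
by move=> Q0 Q1 Q2 Q3 Q4 Q5 [[|[|[|[|[|[|//]]]]]] h]; rewrite (bool_irrelevance h isT).
Qed.

Lemma agree3E (S : {set 'I_3}) (x y : cfg) :
  agree S x y = [&& (o0 \in S) ==> (x o0 == y o0), (o1 \in S) ==> (x o1 == y o1)
                 & (o2 \in S) ==> (x o2 == y o2)].
Proof.
apply/forallP/and3P => [h|[h0 h1 h2]]; first by split; exact: h.
exact: forall_ord3.
Qed.

Lemma agree6E (S : {set 'I_6}) (x y : cfg6) :
  agree S x y = [&& (q0 \in S) ==> (x q0 == y q0), (q1 \in S) ==> (x q1 == y q1),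
                    (q2 \in S) ==> (x q2 == y q2), (q3 \in S) ==> (x q3 == y q3),
                    (q4 \in S) ==> (x q4 == y q4) & (q5 \in S) ==> (x q5 == y q5)].
Proof.
apply/forallP/idP => [h|].
  by apply/and5P; split; try exact: h; apply/andP; split; exact: h.
case/and5P => h0 h1 h2 h3 /andP[h4 h5]; exact: forall_ord6.
Qed.

(** The dimension of a factor computes only once its index is a numeral, hence the match on [m] with
    the bound generalized. Beyond 5 the bound is absurd. *)
Definition join_fun (x x' : cfg) (k : 'I_6) : 'I_(dims6 d1 d2 d3 k) :=
  let: Ordinal m lt_m6 := k in
  match m return forall h : (m < 6)%N, 'I_(dims6 d1 d2 d3 (Ordinal h)) with
  | 0 => fun=> x o0 | 1 => fun=> x o1 | 2 => fun=> x o2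
  | 3 => fun=> x' o0 | 4 => fun=> x' o1 | 5 => fun=> x' o2
  | _ => fun h => False_rect _ (Bool.diff_false_true h)
  end lt_m6.

Definition join (x x' : cfg) : cfg6 := finfun (join_fun x x').

Definition mk3_fun (a : 'I_d1) (b : 'I_d2) (c : 'I_d3) (k : 'I_3) :
    'I_(dims3 d1 d2 d3 k) :=
  let: Ordinal m lt_m3 := k in
  match m return forall h : (m < 3)%N, 'I_(dims3 d1 d2 d3 (Ordinal h)) with
  | 0 => fun=> a | 1 => fun=> b | 2 => fun=> c
  | _ => fun h => False_rect _ (Bool.diff_false_true h)
  end lt_m3.

Definition mk3 a b c : cfg := finfun (mk3_fun a b c).

Lemma joinE (x x' : cfg) :
  (join x x' q0 = x o0) * (join x x' q1 = x o1) * (join x x' q2 = x o2)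
  * (join x x' q3 = x' o0) * (join x x' q4 = x' o1) * (join x x' q5 = x' o2).
Proof. by do !split; rewrite ffunE. Qed.

Definition unjoin (y : cfg6) : cfg * cfg :=
  (mk3 (y q0) (y q1) (y q2), mk3 (y q3) (y q4) (y q5)).

Lemma joinK (x x' : cfg) : unjoin (join x x') = (x, x').
Proof.
rewrite /unjoin !joinE.
by congr pair; apply/ffunP; apply: forall_ord3; rewrite ffunE.
Qed.

Lemma unjoinK (y : cfg6) : join (unjoin y).1 (unjoin y).2 = y.
Proof. by apply/ffunP; apply: forall_ord6; rewrite joinE /unjoin /= ffunE. Qed.

(* Encodes the bipartition g x' of the six factors, with X in the role of x'. *)
Definition setjoin (g X : {set 'I_3}) : {set 'I_6} :=
  [set k : 'I_6 | match val k with
                  | 0 => o0 \in g | 1 => o1 \in g | 2 => o2 \in g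
                  | 3 => o0 \in X | 4 => o1 \in X | _ => o2 \in X end].

Lemma setjoinC g X : ~: setjoin g X = setjoin (~: g) (~: X).
Proof. by apply/setP; apply: forall_ord6; rewrite !inE. Qed.

Lemma agree_join g X x x' y y' :
  agree (setjoin g X) (join x x') (join y y') = agree g x y && agree X x' y'.
Proof. by rewrite agree6E !agree3E !joinE !inE /= !andbA. Qed.

Lemma contracted_join g X x x' y y' z z' w w' :
  contracted (setjoin g X) (join x x') (join y y') (join z z') (join w w') =
  contracted g x y z w && contracted X x' y' z' w'.
Proof.
rewrite /contracted setjoinC !agree_join.
move: (agree g x y) (agree g z w) (agree (~: g) x w) (agree (~: g) y z).
move: (agree X x' y') (agree X z' w') (agree (~: X) x' w') (agree (~: X) y' z').
by do 8!case.
Qed.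

Lemma in_unprimed (g : {set 'I_3}) (k : 'I_6) : (k \in unprimed @: g) =
  match val k with 0 => o0 \in g | 1 => o1 \in g | 2 => o2 \in g | _ => false end.
Proof.
have unprimed_inj : injective unprimed by move=> a b /(congr1 val)/= /val_inj.
have E a b : unprimed a = b -> (b \in unprimed @: g) = (a \in g).
  by move=> <-; rewrite mem_imset.
have N b : (3 <= val b)%N -> (b \in unprimed @: g) = false.
  move=> b3; apply/imsetP => -[a _ ba]; move: b3; rewrite ba /=.
  by rewrite leqNgt ltn_ord.
move: k; apply: forall_ord6 => /=; try exact: N.
- by apply: E; exact: val_inj.
- by apply: E; exact: val_inj.
- by apply: E; exact: val_inj.
Qed.

(** The condition fixes the unprimed part of [S] as [g] and leaves its primed part free, so the sum
    runs over the eight subsets of the primed factors. *)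
Lemma big_setjoin (g : {set 'I_3}) (F : {set 'I_6} -> C) :
  \sum_(S : {set 'I_6} | S :&: ~: primed == unprimed @: g) F S =
  \sum_(X : {set 'I_3}) F (setjoin g X).
Proof.
(* The primed part of [S], which inverts [setjoin g]. *)
pose sp (S : {set 'I_6}) : {set 'I_3} :=
  [set k : 'I_3 | match val k with 0 => q3 \in S | 1 => q4 \in S | _ => q5 \in S end].
rewrite (reindex_onto (setjoin g) sp); last first.
  move=> S /eqP/setP hS; apply/setP; apply: forall_ord6; rewrite !inE //=.
  - by have := hS q0; rewrite in_unprimed !inE /= andbT.
  - by have := hS q1; rewrite in_unprimed !inE /= andbT.
  - by have := hS q2; rewrite in_unprimed !inE /= andbT.
apply: eq_bigl => X; apply/andP; split; apply/eqP/setP.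
  by apply: forall_ord6; rewrite in_unprimed !inE /= ?andbT ?andbF.
by apply: forall_ord3; rewrite !inE.
Qed.

Definition entry (U : 'M[C]_(d1 * d2 * d3)) (x x' : cfg) : C :=
  U (idx3 (x o0) (x o1) (x o2)) (idx3 (x' o0) (x' o1) (x' o2)).

(* Coefficient of psi_{x'} conj psi_{y'} psi_{z'} conj psi_{w'} in
   tr[(tr_g |U psi><U psi|)^2], with r = (x', y', z', w'). *)
Definition kernel4 (U : 'M[C]_(d1 * d2 * d3)) (g : {set 'I_3}) (r : quad cfg) : C :=
  \sum_(q : quad cfg) (contracted g q.1.1.1 q.1.1.2 q.1.2 q.2)%:R
    * entry U q.1.1.1 r.1.1.1 * (entry U q.1.1.2 r.1.1.2)^*
    * entry U q.1.2 r.1.2 * (entry U q.2 r.2)^*.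

(** [quartic_apply] moves U into the kernel, and the remaining quartic monomial of a product vector
    splits into one monomial per factor. *)
Lemma trsq_out_state U g (p1 : 'cV[C]_d1) (p2 : 'cV[C]_d2) (p3 : 'cV[C]_d3) :
  trsq_ptrace g (out_state U p1 p2 p3) =
  \sum_(r : quad cfg) kernel4 U g r *
    (monom4 (r.1.1.1 o0) (r.1.1.2 o0) (r.1.2 o0) (r.2 o0) p1 *
     monom4 (r.1.1.1 o1) (r.1.1.2 o1) (r.1.2 o1) (r.2 o1) p2 *
     monom4 (r.1.1.1 o2) (r.1.1.2 o2) (r.1.2 o2) (r.2 o2) p3).
Proof.
pose v (y : cfg) : C := p1 (y o0) 0 * p2 (y o1) 0 * p3 (y o2) 0.
have outE x : out_state U p1 p2 p3 x = \sum_y entry U x y * v y.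
  by apply: eq_bigr => y _; rewrite /v !mulrA.
rewrite /trsq_ptrace sum_quad.
under eq_bigr => q _ do rewrite !outE.
rewrite quartic_apply; apply: eq_bigr => r _; congr (_ * _).
by rewrite /v /monom4 !rmorphM /=; ring.
Qed.

(** The coordinates of the state of U are its entries up to scale, so the same kernel appears, with
    its primed indices contracted along [X] instead of paired with input states. *)
Lemma trsq_choi_state U g X :
  trsq_ptrace (setjoin g X) (choi_state U) =
  ((d1 * d2 * d3)%N%:R ^+ 2)^-1 *
  \sum_(r : quad cfg) kernel4 U g r
     * (contracted X r.1.1.1 r.1.1.2 r.1.2 r.2)%:R.
Proof.
pose h (p : quad cfg * quad cfg) : quad cfg6 :=
  (join p.1.1.1.1 p.2.1.1.1, join p.1.1.1.2 p.2.1.1.2, join p.1.1.2 p.2.1.2,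
   join p.1.2 p.2.2).
pose h' (q : quad cfg6) : quad cfg * quad cfg :=
  (((unjoin q.1.1.1).1, (unjoin q.1.1.2).1, (unjoin q.1.2).1, (unjoin q.2).1),
   ((unjoin q.1.1.1).2, (unjoin q.1.1.2).2, (unjoin q.1.2).2, (unjoin q.2).2)).
have hK : cancel h h'.
  by move=> [[[[x y] z] w] [[[x' y'] z'] w']]; rewrite /h /h' !joinK.
have h'K : cancel h' h.
  by move=> [[[x y] z] w]; rewrite /h /h' !unjoinK.
rewrite /trsq_ptrace sum_quad (reindex h) /=; last by exists h'; move=> ? _.
rewrite big_distrr /=.
under [RHS]eq_bigr => r _ do rewrite /kernel4 big_distrl big_distrr /=.
rewrite exchange_big pair_bigA /=; apply: eq_bigr => -[q r] _ /=.
rewrite -/(contracted _ _ _ _ _) contracted_join -mulnb natrM.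
pose s : C := sqrtC (d1 * d2 * d3)%N%:R.
(* The normalization is real, so its four occurrences, two of them conjugated, give s^-4 = (d1 d2
   d3)^-2. *)
have sc : (s^-1)^* = s^-1.
  by apply/CrealP; rewrite rpredV ger0_real// sqrtC_ge0.
have -> : (d1 * d2 * d3)%N%:R = s ^+ 2 by rewrite sqrtCK.
rewrite /choi_state -/s !joinE !rmorphM /= sc -!exprVn /entry.
by set i := s^-1; ring.
Qed.
End Bipartition.

(** * Averaged purity and the final formula *)

Lemma sum_kernel4_moments (R : realType) (d1 d2 d3 : nat)
    (hd1 : (0 < d1)%N) (hd2 : (0 < d2)%N) (hd3 : (0 < d3)%N)
    (U : 'M[R[i]]_(d1 * d2 * d3)) dT1 (T1 : measurableType dT1)
    (P1 : probability T1 R) (psi1 : T1 -> 'cV[R[i]]_d1) dT2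
    (T2 : measurableType dT2) (P2 : probability T2 R) (psi2 : T2 -> 'cV[R[i]]_d2)
    dT3 (T3 : measurableType dT3) (P3 : probability T3 R)
    (psi3 : T3 -> 'cV[R[i]]_d3) (g : {set 'I_3}) :
  random_pure_state P1 psi1 -> random_pure_state P2 psi2 ->
  random_pure_state P3 psi3 ->
  \sum_(r : quad (config (dims3 d1 d2 d3))) kernel4 U g r *
    (moment4 P1 psi1 (r.1.1.1 o0) (r.1.1.2 o0) (r.1.2 o0) (r.2 o0) *
     moment4 P2 psi2 (r.1.1.1 o1) (r.1.1.2 o1) (r.1.2 o1) (r.2 o1) *
     moment4 P3 psi3 (r.1.1.1 o2) (r.1.1.2 o2) (r.1.2 o2) (r.2 o2)) =
  (\prod_(k < 3) ((dims3 d1 d2 d3 k)%:R / (dims3 d1 d2 d3 k + 1)%:R))%:C%C *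
    \sum_(S : {set 'I_6} | S :&: ~: primed == unprimed @: g)
      trsq_ptrace S (choi_state U).
Proof.
move=> h1 h2 h3; rewrite big_setjoin.
under [X in _ = _ * X]eq_bigr => S _ do rewrite trsq_choi_state.
rewrite -big_distrr exchange_big !big_distrr /=.
(* For each quadruple, the sum over subsets refolds into the product of the numerators of the three
   moments. *)
apply: eq_bigr => r _; rewrite -big_distrr /= sum_contracted.
rewrite (moment4E h1) (moment4E h2) (moment4E h3) !big_ord_recl !big_ord0 !mulr1.
have -> : lift ord0 (ord0 : 'I_2) = o1 by exact: val_inj.
have -> : lift ord0 (lift ord0 (ord0 : 'I_1)) = o2 by exact: val_inj.
have -> : ord0 = o0 :> 'I_3 by exact: val_inj.
rewrite /dims3 /= !rmorphM /= !fmorphV /= !rmorph_nat !natrD.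
(* The constants match because 1 / (d (d + 1)) = (d / (d + 1)) d^-2 for each factor. *)
have D0 d : (0 < d)%N -> d%:R != 0 :> R[i] by rewrite pnatr_eq0 lt0n.
have D1 d : d%:R + 1 != 0 :> R[i] by rewrite natr1 pnatr_eq0.
by field; rewrite !D1 !D0.
Qed.

Theorem theorem1 (R : realType) (d1 d2 d3 : nat)
  (hd1 : (0 < d1)%N) (hd2 : (0 < d2)%N) (hd3 : (0 < d3)%N)
  (U : 'M[R[i]]_(d1 * d2 * d3)) (hU : special_unitary U)
  (dT1 : measure_display) (T1 : measurableType dT1) (P1 : probability T1 R)
  (psi1 : T1 -> 'cV[R[i]]_d1) (h1 : random_pure_state P1 psi1)
  (dT2 : measure_display) (T2 : measurableType dT2) (P2 : probability T2 R)
  (psi2 : T2 -> 'cV[R[i]]_d2) (h2 : random_pure_state P2 psi2)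
  (dT3 : measure_display) (T3 : measurableType dT3) (P3 : probability T3 R)
  (psi3 : T3 -> 'cV[R[i]]_d3) (h3 : random_pure_state P3 psi3) :
  let eps (g : {set 'I_3}) : R :=
    avg3 P1 P2 P3 (fun t1 t2 t3 =>
      tau3 g (out_state U (psi1 t1) (psi2 t2) (psi3 t3))) in
  let eps1 : R :=
    avg3 P1 P2 P3 (fun t1 t2 t3 =>
      tau1 (out_state U (psi1 t1) (psi2 t2) (psi3 t3))) in
  eps1 = (eps [set o0; o1] + eps [set o0; o2] + eps [set o1; o2]) / 3%:R /\
  forall a b : 'I_3, a != b ->
    eps [set a; b] =
      2 * (1 - (\prod_(k < 3) ((dims3 d1 d2 d3 k)%:R / (dims3 d1 d2 d3 k + 1)%:R))
             * complex.Re (\sum_(S : {set 'I_6} | S :&: ~: primed == unprimed @: [set a; b])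
                             trsq_ptrace S (choi_state U))).
Proof.
move=> eps eps1.
pose m1 (r : quad (config (dims3 d1 d2 d3))) (v : 'cV[R[i]]_d1) :=
  monom4 (r.1.1.1 o0) (r.1.1.2 o0) (r.1.2 o0) (r.2 o0) v.
pose m2 (r : quad (config (dims3 d1 d2 d3))) (v : 'cV[R[i]]_d2) :=
  monom4 (r.1.1.1 o1) (r.1.1.2 o1) (r.1.2 o1) (r.2 o1) v.
pose m3 (r : quad (config (dims3 d1 d2 d3))) (v : 'cV[R[i]]_d3) :=
  monom4 (r.1.1.1 o2) (r.1.1.2 o2) (r.1.2 o2) (r.2 o2) v.
(* The coefficients are left arbitrary so that this serves both a single bipartition and the
   one-tangle. *)
have avgE (c : quad (config (dims3 d1 d2 d3)) -> R[i]) :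
    avg3 P1 P2 P3 (fun t1 t2 t3 => 2 * (1 - complex.Re
      (\sum_r c r * (m1 r (psi1 t1) * m2 r (psi2 t2) * m3 r (psi3 t3))))) =
    2 * (1 - complex.Re (\sum_r c r *
      (cE P1 (fun t => m1 r (psi1 t)) * cE P2 (fun t => m2 r (psi2 t))
       * cE P3 (fun t => m3 r (psi3 t))))).
  rewrite (avg3_affine_sum c (f1 := fun r t => m1 r (psi1 t))
    (f2 := fun r t => m2 r (psi2 t)) (f3 := fun r t => m3 r (psi3 t)))// => r;
  exact: cint_monom4.
have epsE g : eps g = 2 * (1 - complex.Re (\sum_r kernel4 U g r *
      (cE P1 (fun t => m1 r (psi1 t)) * cE P2 (fun t => m2 r (psi2 t))
       * cE P3 (fun t => m3 r (psi3 t))))).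
  rewrite -avgE /eps; congr avg3; apply/funext => t1; apply/funext => t2.
  by apply/funext => t3; rewrite /tau3 trsq_out_state.
have ReZ3 (z : R[i]) : complex.Re (z / 3) = complex.Re z / 3.
  have -> : 3^-1 = (3^-1)%:C%C :> R[i] by rewrite fmorphV rmorph_nat.
  by rewrite complexReM /= mulr0 subr0.
split; last first.
  move=> a b _; rewrite epsE (sum_kernel4_moments hd1 hd2 hd3 U _ h1 h2 h3).
  by rewrite complexReM /= mul0r subr0.
(* The one-tangle has the shape of a single tangle whose kernel is the mean of the three kernels. *)
pose c r := (kernel4 U [set o0; o1] r + kernel4 U [set o0; o2] r
             + kernel4 U [set o1; o2] r) / 3.
have sum_c e : \sum_r c r * e r = (\sum_r kernel4 U [set o0; o1] r * e r
    + \sum_r kernel4 U [set o0; o2] r * e r + \sum_r kernel4 U [set o1; o2] r * e r) / 3.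
  by rewrite -!big_split mulr_suml; apply: eq_bigr => r _; rewrite /c /=; ring.
transitivity (avg3 P1 P2 P3 (fun t1 t2 t3 => 2 * (1 - complex.Re
      (\sum_r c r * (m1 r (psi1 t1) * m2 r (psi2 t2) * m3 r (psi3 t3)))))).
  rewrite /eps1; congr avg3; apply/funext => t1; apply/funext => t2.
  apply/funext => t3; rewrite sum_c ReZ3 !complexReD /tau1 /tau3 !trsq_out_state.
  by field.
by rewrite avgE sum_c ReZ3 !complexReD !epsE; field.
Qed.
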